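(* Let $f=\frac1n\sum_{i=1}^n f_i$ where each $f_i:\mathbb{R}^d\to\mathbb{R}$ is convex and $L_i$-smooth, assume that $f$ is $\mu$-strongly convex ($\mu>0$) with minimizer $x^*$, and let $L_{\max}=\max_{1\le i\le n}L_i$. Then SGD with $\text{SPS}_{\max}$ with $c=1/2$ and $0<\gamma_b\le\frac{1}{L_{\max}}$ becomes SGD with constant step-size $\gamma_k=\gamma:=\gamma_b\le\frac1{L_{\max}}$, and its iterates satisfy, for all $k\ge0$, $$\mathbb{E}\|x^{k}-x^*\|^2\le(1-\mu\gamma)^k\|x^0-x^*\|^2+\frac{2\sigma^2}{\mu}.$$ If in addition interpolation holds ($\sigma=0$), the iterates of SGD with constant step-size $\gamma\le\frac1{L_{\max}}$ satisfy $$\mathbb{E}\|x^{k}-x^*\|^2\le(1-\mu\gamma)^k\|x^0-x^*\|^2.$$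
   Context: Setting: $f(x)=\frac1n\sum_{i=1}^n f_i(x)$ is minimized over $\mathbb{R}^d$, and the set $\mathcal{X}^*$ of minimizers of $f$ is nonempty. A function is $L$-smooth if it is differentiable with $L$-Lipschitz gradient. For each $i$, $f_i^*:=\inf_x f_i(x)$, and it is assumed throughout that $\sigma^2:=\mathbb{E}_i[f_i(x^* )-f_i^*]=f(x^* )-\frac1n\sum_{i=1}^n f_i^*<\infty$ (so all $f_i^*$ are finite), where $x^*\in\mathcal{X}^*$. SGD: starting from a deterministic $x^0$, at each iteration $k$ an index $i\in\{1,\dots,n\}$ is drawn uniformly at random, independently of the past, and $x^{k+1}=x^k-\gamma_k\nabla f_i(x^k)$. $\text{SPS}_{\max}$ with parameters $c>0$ and $\gamma_b>0$: $\gamma_k=\min\left\{\frac{f_i(x^k)-f_i^*}{c\|\nabla f_i(x^k)\|^2},\gamma_b\right\}$, where $i$ is the index drawn at iteration $k$. If $\nabla f_i(x^k)=0$ then $x^{k+1}=x^k$ (so any value, e.g. $\gamma_b$, may be assigned to $\gamma_k$). *)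

(* Defs.v *)
From HB Require Import structures.
From mathcomp Require Import all_boot all_order all_algebra finmap.
From mathcomp Require Import all_classical all_reals all_analysis.

Set Implicit Arguments.
Unset Strict Implicit.
Unset Printing Implicit Defensive.

Import Order.TTheory GRing.Theory Num.Theory.
Import numFieldNormedType.Exports.

Local Open Scope classical_set_scope.
Local Open Scope ring_scope.

(* The canonical norm `|x| of 'rV[R]_d is the sup norm, hence this explicit
   Euclidean norm. *)
Definition enorm (R : realType) (d : nat) (x : 'rV[R]_d) : R :=
  Num.sqrt (\sum_j x 0 j ^+ 2).

Definition gradient (R : realType) (d : nat) (f : 'rV[R]_d -> R)
    (x : 'rV[R]_d) : 'rV[R]_d :=
  \row_j 'D_(delta_mx 0 j) f x.

Definition smooth (R : realType) (d : nat) (L : R) (f : 'rV[R]_d -> R) : Prop :=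
  [/\ 0 <= L,
      forall x, differentiable f x &
      forall x y, enorm (gradient f x - gradient f y) <= L * enorm (x - y)].

Definition strongly_convex (R : realType) (d : nat) (mu : R)
    (f : 'rV[R]_d -> R) : Prop :=
  forall (x y : 'rV[R]_d) (t : R), 0 <= t <= 1 ->
    f (t *: x + (1 - t) *: y) <=
      t * f x + (1 - t) * f y - mu / 2 * t * (1 - t) * enorm (x - y) ^+ 2.

Definition is_minimizer (R : realType) (d : nat) (f : 'rV[R]_d -> R)
    (xs : 'rV[R]_d) : Prop :=
  forall x, f xs <= f x.

Definition average (R : realType) (d n : nat) (f : 'I_n -> 'rV[R]_d -> R) :
    'rV[R]_d -> R :=
  fun x => n%:R^-1 * \sum_i f i x.

(* The default value 0 is harmless: smoothness constants are nonnegative. *)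
Definition maxL (R : realType) (n : nat) (L : 'I_n -> R) : R :=
  \big[Num.max/0]_i L i.

Definition fstar (R : realType) (d : nat) (f : 'rV[R]_d -> R) : \bar R :=
  ereal_inf [set (f x)%:E | x in [set: 'rV[R]_d]].

(* Extended-real valued: it is +oo exactly when some f_i is unbounded below. *)
Definition sigma2 (R : realType) (d n : nat) (f : 'I_n -> 'rV[R]_d -> R)
    (xs : 'rV[R]_d) : \bar R :=
  ((n%:R^-1)%:E * \sum_(i < n) ((f i xs)%:E - fstar (f i)))%E.

(* At a point where the gradient of f_i vanishes the ratio is 0 / 0; the step
   size is then gb (the value is irrelevant for the iterates). *)
Definition sps_max (R : realType) (d n : nat) (f : 'I_n -> 'rV[R]_d -> R)
    (c gb : R) (i : 'I_n) (x : 'rV[R]_d) : R :=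
  if gradient (f i) x == 0 then gb
  else Num.min
    ((f i x - fine (fstar (f i))) / (c * enorm (gradient (f i) x) ^+ 2)) gb.

(* gam i x is the step size used at the point x when the index i is drawn, and
   idx k w is the index drawn at iteration k under the outcome w. *)
Fixpoint sgd (R : realType) (d n : nat) (Omega : Type)
    (f : 'I_n -> 'rV[R]_d -> R) (gam : 'I_n -> 'rV[R]_d -> R)
    (idx : nat -> Omega -> 'I_n) (x0 : 'rV[R]_d) (k : nat) (w : Omega) :
    'rV[R]_d :=
  if k is k'.+1 then
    let x := sgd f gam idx x0 k' w in
    let i := idx k' w in
    x - gam i x *: gradient (f i) x
  else x0.

(* 'I_n carries the discrete sigma-algebra, so every A : set 'I_n is an event. *)
Definition iid_uniform (disp : measure_display) (Omega : measurableType disp)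
    (R : realType) (P : probability Omega R) (n : nat)
    (idx : nat -> Omega -> 'I_n) : Prop :=
  [/\ forall k (A : set 'I_n), measurable (idx k @^-1` A),
      forall k (i : 'I_n), P (idx k @^-1` [set i]) = (n%:R^-1)%:E &
      forall (J : {fset nat}) (A : nat -> set 'I_n),
        P (\bigcap_(k in [set` J]) (idx k @^-1` A k)) =
        (\prod_(k <- J) P (idx k @^-1` A k))%E].

(* Main.v *)
(* With M = maxL L, the descent inequality at y = x - grad f_i(x) / M gives
   |grad f_i(x)|^2 <= 2 M (f_i(x) - f_i^* ). For c = 1/2 the Polyak ratio is
   thus at least 1 / M >= gb, so the minimum in SPS_max is always gb.  For a
   constant step gam <= 1 / M, the same inequality bounds gam^2 |grad f_i(x)|^2
   by 2 gam (f_i(x) - f_i^* ); averaging over i and using the strong convexity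
   of the average yields
     E_i |x - gam grad f_i(x) - xs|^2
       <= (1 - mu gam) |x - xs|^2 + 2 gam sigma^2,
   and 2 sigma^2 / mu is the fixed point of r |-> (1 - mu gam) r + 2 gam sigma^2.
   Since x^k depends only on the first k indices, its expectations are plain
   averages over k-tuples of indices. *)
Require Import Defs.
From HB Require Import structures.
From mathcomp Require Import all_boot all_order all_algebra finmap.
From mathcomp Require Import all_classical all_reals all_analysis.
From mathcomp Require Import measurable_realfun ring lra.

Import Order.TTheory GRing.Theory Num.Theory.
Import numFieldNormedType.Exports.

Local Open Scope classical_set_scope.
Local Open Scope ring_scope.

(** * Euclidean inner product and norm *)

Definition dot {R : realType} {d : nat} (u v : 'rV[R]_d) : R :=
  \sum_j u 0 j * v 0 j.

Section Euclidean.
Context {R : realType} {d : nat}.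
Implicit Types u v w : 'rV[R]_d.

Lemma enorm_sqr u : enorm u ^+ 2 = dot u u.
Proof.
rewrite /enorm sqr_sqrtr; first by apply: eq_bigr => j _; rewrite expr2.
by apply: sumr_ge0 => j _; rewrite sqr_ge0.
Qed.

Lemma enorm_ge0 u : 0 <= enorm u.
Proof. exact: sqrtr_ge0. Qed.

Lemma dotC u v : dot u v = dot v u.
Proof. by apply: eq_bigr => j _; rewrite mulrC. Qed.

Lemma dotDl u v w : dot (u + v) w = dot u w + dot v w.
Proof. by rewrite -big_split; apply: eq_bigr => j _; rewrite mxE mulrDl. Qed.

Lemma dotZl a u v : dot (a *: u) v = a * dot u v.
Proof. by rewrite mulr_sumr; apply: eq_bigr => j _; rewrite mxE mulrA. Qed.

Lemma dotZr a u v : dot u (a *: v) = a * dot u v.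
Proof. by rewrite dotC dotZl dotC. Qed.

Lemma dotNl u v : dot (- u) v = - dot u v.
Proof. by rewrite -scaleN1r dotZl mulN1r. Qed.

Lemma dotNr u v : dot u (- v) = - dot u v.
Proof. by rewrite dotC dotNl dotC. Qed.

Lemma dotBl u v w : dot (u - v) w = dot u w - dot v w.
Proof. by rewrite dotDl dotNl. Qed.

Lemma enormZ_sqr a u : enorm (a *: u) ^+ 2 = a ^+ 2 * enorm u ^+ 2.
Proof. by rewrite !enorm_sqr dotZl dotZr mulrA expr2. Qed.

Lemma enormN u : enorm (- u) = enorm u.
Proof.
by congr Num.sqrt; apply: eq_bigr => j _; rewrite mxE sqrrN.
Qed.

Lemma enormBC u v : enorm (u - v) = enorm (v - u).
Proof. by rewrite -enormN opprB. Qed.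

Lemma enorm_sqrB u v :
  enorm (u - v) ^+ 2 = enorm u ^+ 2 - 2 * dot v u + enorm v ^+ 2.
Proof.
by rewrite !enorm_sqr dotBl [dot u _]dotC [dot v (_ - _)]dotC !dotBl (dotC u v); ring.
Qed.

Lemma enorm_eq0 u : enorm u = 0 -> u = 0.
Proof.
move=> u0; have : dot u u = 0 by rewrite -enorm_sqr u0 expr0n.
move/eqP; rewrite psumr_eq0 => [/allP uu|j _]; last by rewrite -expr2 sqr_ge0.
apply/rowP => j; rewrite mxE; apply/eqP.
by have := uu j (mem_index_enum _); rewrite mulf_eq0 orbb.
Qed.

Lemma enorm_sqr_gt0 u : u != 0 -> 0 < enorm u ^+ 2.
Proof.
move=> u0; rewrite exprn_gt0// lt_def enorm_ge0 andbT.
by apply: contra u0 => /eqP /enorm_eq0 ->.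
Qed.

(** Takes the place of Cauchy-Schwarz when a Lipschitz bound on gradients has to control an inner
    product. *)
Lemma dot_le_of_enorm_le c u v : 0 < c -> enorm u <= c * enorm v ->
  dot u v <= c * enorm v ^+ 2.
Proof.
move=> c0 uv.
(* AM-GM: [2 c <u, v> <= |u|^2 + c^2 |v|^2] *)
have amgm : 2 * c * dot u v <= enorm u ^+ 2 + c ^+ 2 * enorm v ^+ 2.
  have := sqr_ge0 (enorm (u - c *: v)).
  by rewrite enorm_sqrB enormZ_sqr dotZl dotC; lra.
have uv2 : enorm u ^+ 2 <= c ^+ 2 * enorm v ^+ 2.
  by rewrite -exprMn ler_sqr// nnegrE ?enorm_ge0// mulr_ge0 ?enorm_ge0// ltW.
by rewrite -(ler_pM2l c0); nra.
Qed.

End Euclidean.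

(** * Gradients, the descent inequality and strong convexity *)

Section Calculus.
Context {R : realType} {d : nat}.
Implicit Types (f : 'rV[R]_d -> R) (x y v : 'rV[R]_d).

Lemma derive_gradient f x v : differentiable f x ->
  'D_v f x = dot (gradient f x) v.
Proof.
move=> df; rewrite deriveE// {1}(row_sum_delta v) linear_sum.
by apply: eq_bigr => j _; rewrite linearZ /= mxE deriveE// mulrC.
Qed.

(** The difference quotient of the restriction to the line is that of [f] at [x + t *: v] along
    [v]. *)
Lemma is_derive_line f x v (t : R) : differentiable f (x + t *: v) ->
  is_derive t 1 (fun s => f (x + s *: v)) (dot (gradient f (x + t *: v)) v).
Proof.
move=> df.
have E : (fun h : R => h^-1 *: (((fun s => f (x + s *: v)) \o shift t) (h *: 1)
      - f (x + t *: v))) =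
    (fun h : R => h^-1 *: ((f \o shift (x + t *: v)) (h *: v) - f (x + t *: v))).
  apply/funext => h /=; congr (_ *: (f _ - _)).
  by rewrite [h *: 1]mulr1 scalerDl addrCA.
split; first by rewrite /derivable E; exact: diff_derivable.
by rewrite /derive E -derive_gradient.
Qed.

(* The mean value theorem is applied to
   [t |-> f (x + t v) - t <grad f x, v> - M / 2 t^2 |v|^2]. *)
Lemma descent f (M : R) x v : 0 < M -> smooth M f ->
  f (x + v) <= f x + dot (gradient f x) v + M / 2 * enorm v ^+ 2.
Proof.
move=> M0 [_ df lip].
pose D := dot (gradient f x) v; pose N := enorm v ^+ 2.
pose psi t := f (x + t *: v) - (t * D + M / 2 * N * t ^+ 2).
pose dpsi t := dot (gradient f (x + t *: v)) v - (D + M * N * t).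
have dpsiP (t : R) : is_derive t 1 psi (dpsi t).
  have ? := is_derive_line _ _ _ _ (df (x + t *: v)).
  rewrite /psi; apply: is_derive_eq; rewrite /dpsi /GRing.scale /=; lra.
have cpsi : {within `[0, 1], continuous psi}.
  by apply: derivable_within_continuous => t _; case: (dpsiP t).
have [c + +] := @MVT _ psi dpsi 0 1 ltr01 (fun t _ => dpsiP t) cpsi.
rewrite in_itv /= => /andP[c0 c1]; rewrite /psi /dpsi.
rewrite scale1r scale0r addr0 subr0 mulr1 expr0n expr1n mulr0 mul0r addr0 subr0.
(* The gradients at [x + c *: v] and [x] are compared at distance [c * enorm v], so
   [dpsi c <= 0]. *)
have := @dot_le_of_enorm_le _ _ (M * c) (gradient f (x + c *: v) - gradient f x) v.
rewrite mulr_gt0// => /(_ isT) H.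
have {H}: dot (gradient f (x + c *: v) - gradient f x) v <= M * c * N.
  apply: H; apply: (le_trans (lip _ _)); rewrite addrC addKr -mulrA ler_pM2l//.
  rewrite -ler_sqr ?nnegrE ?enorm_ge0//; last by rewrite mulr_ge0 ?enorm_ge0// ltW.
  by rewrite enormZ_sqr exprMn.
rewrite dotBl -/D -/N; lra.
Qed.

Lemma gradient_enorm_le f (M m : R) x : 0 < M -> smooth M f ->
  (forall y, m <= f y) -> enorm (gradient f x) ^+ 2 <= 2 * M * (f x - m).
Proof.
move=> M0 fM lb; pose g := gradient f x.
(* The step [- M^-1 *: g] minimizes the quadratic upper bound given by [descent]. *)
have := le_trans (lb _) (descent f M x (- M^-1 *: g) M0 fM).
rewrite dotZr enormZ_sqr -/g -enorm_sqr sqrrN.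
set N := enorm g ^+ 2 => H.
have MV : M * M^-1 = 1 by rewrite divff// gt_eqF.
have E : M / 2 * (M^-1 ^+ 2 * N) = (M * M^-1) * M^-1 * N / 2 by ring.
have : M * (M^-1 * N) <= M * (2 * (f x - m)).
  rewrite ler_pM2l//; move: H; rewrite E MV; lra.
by rewrite [M * (M^-1 * N)]mulrA MV mul1r mulrA [M * 2]mulrC.
Qed.

(** The convexity inequality at [t *: y + (1 - t) *: x] is divided by [t > 0]; then [t] tends to 0
    from the right. *)
Lemma strongly_convex_derive f (mu : R) x y : strongly_convex mu f ->
  derivable f x (y - x) ->
  'D_(y - x) f x <= f y - f x - mu / 2 * enorm (x - y) ^+ 2.
Proof.
move=> fmu dfx; pose N := enorm (x - y) ^+ 2.
have qcvg := @cvg_dnbhs_at_right _ _ _ _ _ dfx.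
have rcvg : (f y - f x - mu / 2 * N + mu / 2 * N * t) @[t --> (0 : R)^'+] -->
    f y - f x - mu / 2 * N.
  apply: cvg_at_right_filter; rewrite -[X in _ --> X]addr0.
  apply: cvgD; first exact: cvg_cst.
  by rewrite -[X in _ --> X](mulr0 (mu / 2 * N)); apply: cvgMr; exact: cvg_id.
apply: (ler_cvg_to qcvg rcvg); near=> t.
have t0 : 0 < t by near: t; exact: nbhs_right_gt.
have t1 : t <= 1 by near: t; apply: nbhs_right_le.
have := fmu y x t; rewrite (ltW t0) t1 => /(_ isT).
rewrite enormBC -/N /= /GRing.scale /= => H.
rewrite ler_pdivrMl//.
have -> : t *: (y - x) + x = t *: y + (1 - t) *: x.
  by rewrite scalerBr scalerBl scale1r addrAC addrA.
nra.
Unshelve. all: by end_near.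
Qed.

End Calculus.

(** * Index histories and their uniform law *)

Section Draws.
Context {Omega : Type} {n : nat} (idx : nat -> Omega -> 'I_n).

(** The latest draw comes first, so that the recursion follows that of [sgd]. *)
Fixpoint draws (k : nat) (w : Omega) : seq 'I_n :=
  if k is k'.+1 then idx k' w :: draws k' w else [::].

Lemma drawsE k w : draws k w = rev (mkseq (idx^~ w) k).
Proof.
by elim: k => //= k ->; rewrite /mkseq -addn1 iotaD map_cat rev_cat.
Qed.

Lemma size_draws k w : size (draws k w) == k.
Proof. by rewrite drawsE size_rev size_mkseq. Qed.

End Draws.

Section UniformDraws.
Context {disp : measure_display} {Omega : measurableType disp} {R : realType}.
Context (P : probability Omega R) {n : nat} (idx : nat -> Omega -> 'I_n).

Context (idx_iid : iid_uniform P idx).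

(** Brings the event into the form of the independence hypothesis. The index [i0] is only the
    default of [nth]; [rev] restores the order of time. *)
Lemma draws_preimage (i0 : 'I_n) k (t : k.-tuple 'I_n) :
  [set w | draws idx k w = t] =
  \bigcap_(j in [set` [fset j in iota 0 k]%fset])
    idx j @^-1` [set nth i0 (rev t) j].
Proof.
apply/seteqP; split => w /=.
  move=> tE j /=; rewrite inE mem_iota /= => jk.
  by rewrite -tE drawsE revK nth_mkseq.
move=> H; rewrite drawsE -[RHS]revK; congr rev.
apply: (@eq_from_nth _ i0); rewrite size_mkseq ?size_rev ?size_tuple// => j jk.
by rewrite nth_mkseq// H//= inE mem_iota.
Qed.

Lemma draws_measurable k (t : k.-tuple 'I_n) :
  measurable [set w | draws idx k w = t].
Proof.
(* For [k = 0] there is no [thead t] to serve as default of [nth]; the event is then the whole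
   space. *)
case: idx_iid => mi _ _; case: k t => [|k] t.
  rewrite tuple0 (_ : [set _ | _] = setT)//.
  by apply/seteqP; split.
rewrite (draws_preimage (thead t)); exact: fin_bigcap_measurable.
Qed.

Lemma draws_uniform k (t : k.-tuple 'I_n) :
  P [set w | draws idx k w = t] = ((n%:R^-1) ^+ k)%:E.
Proof.
case: idx_iid => _ unif indep; case: k t => [|k] t.
  rewrite tuple0 (_ : [set _ | _] = setT) ?probability_setT//.
  by apply/seteqP; split.
rewrite (draws_preimage (thead t)) indep.
under eq_bigr do rewrite unif.
rewrite prodEFin big_const_seq count_predT iter_mulr_1.
by rewrite -[size _]/(#|` _|)%fset card_fseq undup_id ?iota_uniq// size_iota.
Qed.

(** [F] is defined on sequences rather than tuples, so that [k] can vary without casts. *)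
Definition tuple_mean k (F : seq 'I_n -> R) : R :=
  (n%:R^-1) ^+ k * \sum_(t : k.-tuple 'I_n) F t.

(** [F (draws idx k w)] is a finite sum of constants [F t] times indicators of events of probability
    [n^-k]; nonnegativity lets sum and integral be exchanged. *)
Lemma expectation_draws k (F : seq 'I_n -> R) : (forall s, 0 <= F s) ->
  ('E_P[fun w => F (draws idx k w)] = (tuple_mean k F)%:E)%E.
Proof.
move=> F0; rewrite unlock.
have FE w : (F (draws idx k w))%:E =
    (\sum_(t : k.-tuple 'I_n) (F t * \1_[set w | draws idx k w = t] w)%:E)%E.
  rewrite sumEFin (bigD1 (Tuple (size_draws idx k w)))//= big1 ?addr0 => [|t tw].
    by rewrite indicE mem_set// mulr1.
  rewrite indicE memNset ?mulr0//= => tE.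
  by case/eqP: tw; apply/val_inj.
under eq_integral do rewrite FE.
rewrite ge0_integral_sum//; last 2 first.
- move=> t; apply/measurable_EFinP; apply: measurable_funM => //.
  by apply: measurable_indic; exact: draws_measurable.
- by move=> t w _; rewrite lee_fin mulr_ge0.
rewrite /tuple_mean mulr_sumr -sumEFin; apply: eq_bigr => t _.
rewrite (@integralZl_indic _ _ _ _ _ _ (fun=> [set w | draws idx k w = t]))//.
- rewrite integral_indic//; last exact: draws_measurable.
  rewrite setIT [RHS]EFinM muleC; congr (_ * _)%E; exact: draws_uniform.
- by rewrite ltNge F0.
- exact: draws_measurable.
Qed.

Lemma sum_tupleS k (F : seq 'I_n -> R) :
  \sum_(t : k.+1.-tuple 'I_n) F t =
  \sum_(t : k.-tuple 'I_n) \sum_i F (i :: t).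
Proof.
rewrite exchange_big pair_bigA.
rewrite (reindex (fun p : 'I_n * k.-tuple 'I_n => cons_tuple p.1 p.2))//=.
exists (fun t => (thead t, behead_tuple t)) => [[i t] _|t _] /=.
  by congr pair; apply/val_inj.
by rewrite [RHS]tuple_eta; apply/val_inj.
Qed.

(** Averaging over the latest draw first: the finite form of conditioning on the past. *)
Lemma tuple_meanS k (F : seq 'I_n -> R) :
  tuple_mean k.+1 F = tuple_mean k (fun s => n%:R^-1 * \sum_i F (i :: s)).
Proof.
by rewrite /tuple_mean sum_tupleS -mulr_sumr exprSr mulrA.
Qed.

Lemma le_tuple_mean k (F G : seq 'I_n -> R) : (forall s, F s <= G s) ->
  tuple_mean k F <= tuple_mean k G.
Proof.
move=> FG; apply: ler_wpM2l; first by rewrite exprn_ge0// invr_ge0.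
by apply: ler_sum => t _; exact: FG.
Qed.

Lemma tuple_mean_affine k (a b : R) (F : seq 'I_n -> R) : (0 < n)%N ->
  tuple_mean k (fun s => a * F s + b) = a * tuple_mean k F + b.
Proof.
move=> n0; rewrite /tuple_mean big_split/= -mulr_sumr mulrDr mulrCA; congr +%R.
(* The [n ^ k] tuples have total weight 1, as [n] is nonzero. *)
rewrite sumr_const card_tuple card_ord -[X in _ * X]mulr_natl natrX mulrA.
by rewrite -exprMn mulVf ?expr1n ?mul1r// pnatr_eq0 -lt0n.
Qed.

End UniformDraws.

(** * SGD with constant step: one-step estimate and its iteration *)

Section SGD.
Context {R : realType} {d n : nat} (f : 'I_n -> 'rV[R]_d -> R).
Implicit Types (gam mu : R) (x xs v : 'rV[R]_d).

(* The indices are listed with the most recent draw first. *)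
Definition sgd_run gam x0 (s : seq 'I_n) : 'rV[R]_d :=
  foldr (fun i x => x - gam *: gradient (f i) x) x0 s.

Lemma sgd_draws gam (Omega : Type) (idx : nat -> Omega -> 'I_n) x0 k w :
  sgd f (fun _ _ => gam) idx x0 k w = sgd_run gam x0 (draws idx k w).
Proof. by elim: k => //= k ->. Qed.

Context (n_gt0 : (0 < n)%N) (M : R) (M_gt0 : 0 < M).
Context (f_smooth : forall i, smooth M (f i)).
Context (m : 'I_n -> R) (m_le : forall i x, m i <= f i x).

Lemma derive_average x v :
  derivable (average f) x v /\
  'D_v (average f) x = n%:R^-1 * \sum_i dot (gradient (f i) x) v.
Proof.
have df i : is_derive x v (f i) (dot (gradient (f i) x) v).
  have [_ /(_ x) dfi _] := f_smooth i.
  by split; [exact: diff_derivable|exact: derive_gradient].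
have avgE : average f = n%:R^-1 *: \sum_i f i.
  by apply/funext => y; rewrite /average fctE fct_sumE.
by rewrite avgE; split; [|rewrite derive_val].
Qed.

Context (mu : R) (mu_gt0 : 0 < mu) (avg_sconvex : strongly_convex mu (average f)).
Context (gam : R) (gam_gt0 : 0 < gam) (gam_le : gam <= 1 / M).
Context (xs : 'rV[R]_d).
(** This is sigma^2 when each [m i] is the infimum of [f i]; here [m] is any family of lower
    bounds. *)
Let S := n%:R^-1 * \sum_i (f i xs - m i).

Lemma mean_gap_ge0 : 0 <= S.
Proof.
rewrite mulr_ge0 ?invr_ge0//; apply: sumr_ge0 => i _; rewrite subr_ge0; exact: m_le.
Qed.

Lemma sgd_step x :
  n%:R^-1 * \sum_i enorm (x - gam *: gradient (f i) x - xs) ^+ 2 <=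
  (1 - mu * gam) * enorm (x - xs) ^+ 2 + 2 * gam * S.
Proof.
pose N := enorm (x - xs) ^+ 2.
have n0 : n%:R != 0 :> R by rewrite pnatr_eq0 -lt0n.
have gM : gam * M <= 1 by rewrite -ler_pdivlMr.
have stepi i : enorm (x - gam *: gradient (f i) x - xs) ^+ 2 <=
    N + 2 * gam * dot (gradient (f i) x) (xs - x) + 2 * gam * (f i x - m i).
  have G := gradient_enorm_le _ _ _ x M_gt0 (f_smooth i) (m_le i).
  rewrite addrAC enorm_sqrB enormZ_sqr dotZl -[xs - x]opprB dotNr -/N.
  have fm : 0 <= f i x - m i by rewrite subr_ge0.
  have : gam ^+ 2 * enorm (gradient (f i) x) ^+ 2 <= 2 * gam * (f i x - m i).
    apply: (le_trans (ler_wpM2l (sqr_ge0 _) G)).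
    rewrite [leLHS](_ : _ = gam * M * (2 * gam * (f i x - m i))); last by ring.
    by rewrite ler_piMl// !mulr_ge0// ltW.
  lra.
have [dav davE] := derive_average x (xs - x).
have := strongly_convex_derive _ _ _ _ avg_sconvex dav; rewrite davE -/N => SC.
apply: (@le_trans _ _ (N + 2 * gam *
    (n%:R^-1 * \sum_i dot (gradient (f i) x) (xs - x)) +
    2 * gam * (average f x - n%:R^-1 * \sum_i m i))).
  apply: (le_trans (ler_wpM2l _ (ler_sum _ (fun i _ => stepi i)))).
    by rewrite invr_ge0.
  rewrite !big_split/= sumr_const card_ord -!mulr_sumr big_split/= sumrN /average.
  rewrite -mulr_natl le_eqVlt; apply/orP; left; apply/eqP; field; exact: n0.
have SE : S = average f xs - n%:R^-1 * \sum_i m i.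
  by rewrite /S big_split/= sumrN mulrBr.
rewrite SE.
(* Strong convexity times [2 * gam] bounds the inner product term; the values [average f x] then
   cancel. *)
have := ler_wpM2l (ltW gam_gt0) SC; lra.
Qed.

(* The left-hand side of [sgd_step] stays nonnegative as [x] moves to infinity. *)
Lemma contraction_ge0 v : v != 0 -> 0 <= 1 - mu * gam.
Proof.
move=> v0; rewrite leNgt; apply/negP => q0.
pose q := - (1 - mu * gam); have q1 : 0 < q by rewrite oppr_gt0.
have N0 := enorm_sqr_gt0 v v0.
(* With this [t], the right-hand side of [sgd_step] at [xs + t *: v] equals -1. *)
pose t := Num.sqrt ((2 * gam * S + 1) / (q * enorm v ^+ 2)).
have C0 : 0 < 2 * gam * S + 1.
  by apply: ltr_wpDl => //; apply: mulr_ge0 mean_gap_ge0; rewrite mulr_ge0// ltW.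
have tE : q * (t ^+ 2 * enorm v ^+ 2) = 2 * gam * S + 1.
  rewrite sqr_sqrtr; last by rewrite divr_ge0// ltW// mulr_gt0.
  by rewrite mulrCA divfK// gt_eqF// mulr_gt0.
have tvE : xs + t *: v - xs = t *: v by rewrite addrC addKr.
have := sgd_step (xs + t *: v).
rewrite tvE [enorm (t *: v) ^+ 2]enormZ_sqr leNgt => /negP; apply.
apply: (@lt_le_trans _ _ 0); first by rewrite -[1 - _]opprK mulNr tE; lra.
rewrite mulr_ge0 ?invr_ge0//; apply: sumr_ge0 => i _; exact: sqr_ge0.
Qed.

Lemma sgd_mean x0 k :
  tuple_mean k (fun s => enorm (sgd_run gam x0 s - xs) ^+ 2) <=
  (1 - mu * gam) ^+ k * enorm (x0 - xs) ^+ 2 + 2 / mu * S.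
Proof.
have C0 : 0 <= 2 / mu * S by apply: mulr_ge0 mean_gap_ge0; rewrite divr_ge0// ltW.
(* If the zero vector is the only one, [contraction_ge0] does not apply, but every norm vanishes. *)
have [[v v0]|triv] := pselect (exists v : 'rV[R]_d, v != 0); last first.
  have e0 (u : 'rV[R]_d) : enorm u ^+ 2 = 0.
    have [->|u0] := eqVneq u 0; last by case: triv; exists u.
    by rewrite -(scale0r (0 : 'rV[R]_d)) enormZ_sqr expr0n mul0r.
  rewrite e0 mulr0 add0r /tuple_mean big1 ?mulr0// => t _; exact: e0.
have q0 := contraction_ge0 v v0.
elim: k => [|k IH].
  rewrite /tuple_mean expr0 !mul1r.
  rewrite (eq_bigr (fun=> enorm (x0 - xs) ^+ 2)) => [|t _]; last by rewrite tuple0.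
  by rewrite sumr_const card_tuple expn0 mulr1n lerDl.
rewrite tuple_meanS.
apply: (le_trans (le_tuple_mean _ _ _ (fun s => sgd_step (sgd_run gam x0 s)))).
rewrite tuple_mean_affine//.
apply: (le_trans (lerD (ler_wpM2l q0 IH) (lexx _))).
(* What the contraction removes from [2 / mu * S] is exactly the new noise [2 * gam * S]. *)
have : mu * gam * (2 / mu * S) = 2 * gam * S by field; rewrite gt_eqF.
by rewrite [_ ^+ k.+1]exprS; set p := _ ^+ k; lra.
Qed.

End SGD.

(** * Monotonicity in the smoothness constant; finiteness of the infima *)

Lemma le_maxL (R : realType) (n : nat) (L : 'I_n -> R) i : L i <= maxL L.
Proof. exact: le_bigmax. Qed.

Lemma le_smooth (R : realType) (d : nat) (L M : R) (f : 'rV[R]_d -> R) :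
  L <= M -> smooth L f -> smooth M f.
Proof.
move=> LM [L0 df lip]; split=> //; first exact: le_trans LM.
by move=> x y; apply: (le_trans (lip x y)); rewrite ler_wpM2r// enorm_ge0.
Qed.

Section Sigma2.
Context {R : realType} {d n : nat} {f : 'I_n -> 'rV[R]_d -> R} {xs : 'rV[R]_d}.
Context (n_gt0 : (0 < n)%N) (sigma2_fin : (sigma2 f xs < +oo)%E).

Lemma fstar_le (g : 'rV[R]_d -> R) x : (fstar g <= (g x)%:E)%E.
Proof. by apply: ereal_inf_lbound; exists x. Qed.

(** An infimum equal to -oo would make its term +oo; as every infimum is below +oo, no term is -oo,
    so the sum and [sigma2] would be +oo. *)
Lemma fstar_fin_num i : fstar (f i) \is a fin_num.
Proof.
have ltoo j : (fstar (f j) < +oo)%E by apply: le_lt_trans (fstar_le _ 0) (ltry _).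
rewrite fin_numElt ltoo andbT ltNye; apply/negP => /eqP fi.
move: sigma2_fin; rewrite ltey /sigma2 => /negP; apply; apply/eqP.
have -> : (\sum_(i < n) ((f i xs)%:E - fstar (f i)) = +oo)%E.
  apply/eqP; rewrite esum_eqy => [|j _].
    by apply/existsP; exists i; rewrite fi.
  by rewrite -ltNye; case: (fstar (f j)) (ltoo j) => //= r _; rewrite ltNyr.
by rewrite gt0_muley// lte_fin invr_gt0 ltr0n.
Qed.

Lemma fine_fstar_le i x : fine (fstar (f i)) <= f i x.
Proof. by rewrite -lee_fin fineK ?fstar_fin_num ?fstar_le. Qed.

Lemma sigma2E :
  sigma2 f xs = (n%:R^-1 * \sum_i (f i xs - fine (fstar (f i))))%:E.
Proof.
rewrite /sigma2 EFinM -sumEFin; congr (_ * _)%E.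
by apply: eq_bigr => i _; rewrite EFinB fineK// fstar_fin_num.
Qed.

End Sigma2.

Theorem corollary3p3 (R : realType) (d n : nat)
    (f : 'I_n -> 'rV[R]_d -> R) (L : 'I_n -> R) (mu : R)
    (x0 xs : 'rV[R]_d)
    (disp : measure_display) (Omega : measurableType disp)
    (P : probability Omega R) (idx : nat -> Omega -> 'I_n) (gb : R)
    (n_gt0 : (0 < n)%N)
    (f_convex : forall i, convex_function [set: 'rV[R]_d] (f i))
    (f_smooth : forall i, smooth (L i) (f i))
    (mu_gt0 : 0 < mu)
    (avg_sconvex : strongly_convex mu (average f))
    (xs_min : is_minimizer (average f) xs)
    (sigma2_fin : (sigma2 f xs < +oo)%E)
    (idx_iid : iid_uniform P idx)
    (gb_gt0 : 0 < gb)
    (gb_le : gb <= 1 / maxL L) :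
  let sps := sps_max f (1 / 2) gb in
  let x := sgd f sps idx x0 in
  let xconst := fun gam : R => sgd f (fun _ _ => gam) idx x0 in
  [/\ (forall k w, sps (idx k w) (x k w) = gb),
      (forall k w, x k w = xconst gb k w),
      (forall k,
        ('E_P[fun w => (enorm (x k w - xs) ^+ 2)%R] <=
         ((1 - mu * gb) ^+ k * enorm (x0 - xs) ^+ 2)%:E
         + (2 / mu)%:E * sigma2 f xs)%E) &
      (sigma2 f xs = 0%E ->
       forall gam : R, 0 < gam -> gam <= 1 / maxL L ->
       forall k,
        ('E_P[fun w => (enorm (xconst gam k w - xs) ^+ 2)%R] <=
         ((1 - mu * gam) ^+ k * enorm (x0 - xs) ^+ 2)%:E)%E)].
Proof.
move=> sps x xconst.
(* Division by zero: [1 / maxL L = 0] if [maxL L = 0]. *)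
have M_gt0 : 0 < maxL L by rewrite -invr_gt0 -div1r (lt_le_trans gb_gt0).
have fM i : smooth (maxL L) (f i) by apply: le_smooth (f_smooth i); exact: le_maxL.
have m_le i y := fine_fstar_le n_gt0 sigma2_fin i y.
(* Shown at every point, not only along the iterates, so that [xE] follows by induction. *)
have spsE i y : sps i y = gb.
  rewrite /sps /sps_max; case: ifPn => // g0; apply/min_idPr.
  have G := gradient_enorm_le _ _ _ y M_gt0 (fM i) (m_le i).
  have N0 := enorm_sqr_gt0 _ g0.
  apply: (le_trans gb_le); rewrite ler_pdivlMr; last by rewrite mulr_gt0// divr_gt0.
  by rewrite div1r ler_pdivrMl//; lra.
have xE k w : x k w = xconst gb k w.
  by elim: k => // k IH; rewrite /x /xconst /= -/sps spsE -/(x k w) IH.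
(* Stated for every admissible constant step: it serves [gb] through [xE], and the interpolation
   case. *)
have bound gam (gam_gt0 : 0 < gam) (gam_le : gam <= 1 / maxL L) k :
    ('E_P[fun w => (enorm (xconst gam k w - xs) ^+ 2)%R] <=
     ((1 - mu * gam) ^+ k * enorm (x0 - xs) ^+ 2)%:E
     + (2 / mu)%:E * sigma2 f xs)%E.
  rewrite (sigma2E n_gt0 sigma2_fin) -EFinM -EFinD.
  pose F s := enorm (sgd_run f gam x0 s - xs) ^+ 2.
  rewrite (_ : (fun w => _) = (fun w => F (draws idx k w))); last first.
    by apply/funext => w; rewrite /F -sgd_draws.
  rewrite (@expectation_draws _ _ _ _ _ _ idx_iid) => [|s]; last exact: sqr_ge0.
  by rewrite lee_fin; exact: (sgd_mean _ n_gt0 _ M_gt0 fM _ m_le).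
split=> // [k|sigma0 gam gam_gt0 gam_le k].
  rewrite (_ : (fun w => _) = (fun w => enorm (xconst gb k w - xs) ^+ 2)).
    exact: bound.
  by apply/funext => w; rewrite xE.
by have := bound gam gam_gt0 gam_le k; rewrite sigma0 mule0 adde0.
Qed.
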